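(* Let $a,b,c,d$ be real numbers and let $f(x)$ and $g(x)$ be two real polynomials whose leading coefficients have the same sign. Put $F(x)=(bx+a)f(x)+(dx+c)g(x)$. Suppose that $f,g\in\mathbf{RZ}$ and $g\leadsto f$. If $ad\ge bc$, then $F(x)\in\mathbf{RZ}$.
   Context: $\mathbf{RZ}$ denotes the set of real polynomials having only real zeros; by convention $\mathbf{RZ}$ contains all real constants. For $f,g\in\mathbf{RZ}$ with zeros $r_n\le\cdots\le r_1$ of $f$ and $s_m\le\cdots\le s_1$ of $g$: $g$ interlaces $f$ if $m=n-1$ and $r_n\le s_{n-1}\le r_{n-1}\le\cdots\le r_2\le s_1\le r_1$; $g$ alternates left of $f$ if $m=n$ and $s_n\le r_n\le s_{n-1}\le r_{n-1}\le\cdots\le r_2\le s_1\le r_1$. The notation $g\leadsto f$ means that either $g$ interlaces $f$ or $g$ alternates left of $f$. By convention, $a\leadsto bx+c$ for all real constants $a,b,c$. *)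

(* Defs.v *)
From HB Require Export structures.
From mathcomp Require Export all_boot all_order all_algebra.
From mathcomp Require Export complex reals.

Set Implicit Arguments.
Unset Strict Implicit.
Unset Printing Implicit Defensive.

Import Order.TTheory GRing.Theory Num.Theory.
Local Open Scope ring_scope.

(* The first disjunct only matters for p = 0, of which every complex number is
   a zero. *)
Definition RZ (R : rcfType) (p : {poly R}) : Prop :=
  (exists c : R, p = c%:P) \/
  (forall z : R[i], root (map_poly (real_complex R) p) z -> complex.Im z = 0).

(* s lists the zeros of p with multiplicity in weakly decreasing order, so the
   zero r_i of the mathematical text is the entry of index i - 1.  The zero
   polynomial, which would otherwise factor along any s, has no such list. *)
Definition zeros (R : rcfType) (p : {poly R}) (s : seq R) : Prop :=
  [/\ p != 0, sorted >=%R s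
    & p = lead_coef p *: \prod_(x <- s) ('X - x%:P)].

Definition interlaces (R : rcfType) (g f : {poly R}) : Prop :=
  exists r s : seq R,
    [/\ zeros f r, zeros g s, size r = (size s).+1
      & forall i, (i < size s)%N -> r`_i.+1 <= s`_i <= r`_i].

Definition alternates_left (R : rcfType) (g f : {poly R}) : Prop :=
  exists r s : seq R,
    [/\ zeros f r, zeros g s, size s = size r,
        forall i, (i < size r)%N -> s`_i <= r`_i
      & forall i, (i.+1 < size r)%N -> r`_i.+1 <= s`_i].

(* The last disjunct is the convention a ~> b x + c for all constants a, b, c,
   zero included. *)
Definition leadsto (R : rcfType) (g f : {poly R}) : Prop :=
  [\/ interlaces g f, alternates_left g f
    | exists a b c : R, g = a%:P /\ f = b *: 'X + c%:P].

(* Main.v *)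
Require Import Defs.
From mathcomp Require Import ring lra.

Import Order.TTheory GRing.Theory Num.Theory.
Local Open Scope ring_scope.

(** Let [z] lie in the open upper half-plane.  If the zeros of [f] and [g]
    alternate, then [f z / g z] has argument in [[0, pi)], because it is a
    product of quotients [(z - r_i) / (z - s_i)] whose arguments are the angles
    under which [z] sees non-overlapping intervals; so [Im (f z / g z) > 0]
    unless [f] and [g] are proportional.  On the other hand [F z = 0] gives
    [f z / g z = - (d z + c) / (b z + a)], whose imaginary part is a negative
    multiple of [a d - b c].  Hence a nonreal zero of [F] forces [F = 0]. *)

Set Implicit Arguments.
Unset Strict Implicit.

Section UpperHalfPlane.

Variable R : rcfType.
Implicit Types (p f g : {poly R}) (r s : seq R) (z u v w : R[i]).

Definition evalC p z : R[i] := (map_poly (real_complex R) p).[z].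

(* The imaginary part of [u * v^*], whose sign is that of [Im (u / v)]. *)
Definition cross u v : R :=
  complex.Im u * complex.Re v - complex.Re u * complex.Im v.

Definition root_eval s z : R[i] := \prod_(x <- s) (z - (x%:C)%C).

Lemma evalC_linear (a b : R) z :
  evalC (b *: 'X + a%:P) z = (b%:C)%C * z + (a%:C)%C.
Proof.
by rewrite /evalC rmorphD /= linearZ /= map_polyX map_polyC !hornerE.
Qed.

Lemma evalC_mul p q z : evalC (p * q) z = evalC p z * evalC q z.
Proof. by rewrite /evalC rmorphM hornerM. Qed.

Lemma evalC_add p q z : evalC (p + q) z = evalC p z + evalC q z.
Proof. by rewrite /evalC rmorphD hornerD. Qed.

Lemma evalC_conj p z : evalC p (z^*)%C = ((evalC p z)^*)%C.
Proof.
rewrite /evalC -horner_map -map_poly_comp; congr horner.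
by apply: eq_map_poly => x /=; rewrite oppr0.
Qed.

Lemma evalC_zeros p s z :
  zeros p s -> evalC p z = ((lead_coef p)%:C)%C * root_eval s z.
Proof.
case=> _ _ {1}->; rewrite /evalC linearZ /= hornerZ rmorph_prod horner_prod.
congr (_ * _); apply: eq_bigr => x _.
by rewrite rmorphB /= map_polyX map_polyC !hornerE.
Qed.

Lemma linear_no_upper_root (a b : R) z :
  0 < complex.Im z -> (b%:C)%C * z + (a%:C)%C = 0 -> b = 0 /\ a = 0.
Proof.
case: z => x y /= y0 [] e1 e2.
have b0 : b = 0.
  have /eqP : b * y = 0 by lra.
  by rewrite mulf_eq0 (gt_eqF y0) orbF => /eqP.
by split => //; move: e1; rewrite b0; lra.
Qed.

Lemma root_eval_neq0 s z : 0 < complex.Im z -> root_eval s z != 0.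
Proof.
move=> z0; rewrite prodf_seq_neq0; apply/allP => x _ /=.
by case: z z0 => p q /= q0; rewrite eq_complex /= oppr0 addr0 (gt_eqF q0) andbF.
Qed.

(** Nonreal zeros of a real polynomial come in conjugate pairs, so the upper half-plane suffices.
    Concluding [p = 0] rather than a contradiction accommodates the zero polynomial, which [RZ]
    admits. *)
Lemma RZ_no_upper_root p :
  (forall z, 0 < complex.Im z -> evalC p z = 0 -> p = 0) -> RZ p.
Proof.
move=> H; have [p0|pN0] := eqVneq p 0; first by left; exists 0.
right=> z /rootP pz; case: (ltgtP (complex.Im z) 0) => // z0.
- have := H (z^*)%C; rewrite evalC_conj {1}/evalC pz; case: z z0 {pz} => x y /= y0.
  rewrite oppr_gt0 => /(_ y0) /=; rewrite oppr0 => /(_ erefl) p0.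
  by rewrite p0 eqxx in pN0.
- by have := H z z0 pz => p0; rewrite p0 eqxx in pN0.
Qed.

(* The second conclusion says that [arg (P / Q) < arg (z - x)] for every [x]
   right of all the zeros; it is what makes the induction go through. *)
Lemma cross_alternating z r s : 0 < complex.Im z -> size s = size r ->
  (forall i, (i < size r)%N -> s`_i <= r`_i) ->
  (forall i, (i.+1 < size r)%N -> r`_i.+1 <= s`_i) ->
  let P := root_eval r z in let Q := root_eval s z in
  (r = s \/ 0 < cross P Q) /\
  (forall x : R, ((0 < size r)%N -> r`_0 <= x) ->
     0 < cross ((z - (x%:C)%C) * Q) P).
Proof.
move=> z0; elim: r s => [|r0 r IH] [|s0 s] //=.
  move=> _ _ _; split; first by left.
  move=> x _; rewrite /root_eval !big_nil; case: z z0 => u v /= v0.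
  by rewrite /cross /=; lra.
case=> ss h1 h2.
have [] := IH s ss (fun i => h1 i.+1) (fun i => h2 i.+1).
(* The second induction conclusion is taken at [x = s0], which lies right of the remaining zeros in
   [r]. *)
move=> hA /(_ s0 (fun h => h2 0%N h)); rewrite /root_eval !big_cons -!/(root_eval _ _).
set P := root_eval r z; set Q := root_eval s z => hB.
have r0s0 : s0 <= r0 by exact: (h1 0%N).
have A0 : 0 <= cross P Q.
  by case: hA => [e|/ltW//]; rewrite /P /Q e /cross mulrC subrr.
(* Write [z - r0] as [(z - s0) - (r0 - s0)] and use that [cross] is bilinear and antisymmetric over
   the reals. *)
have step : cross ((z - (r0%:C)%C) * P) ((z - (s0%:C)%C) * Q) =
    ((complex.Re z - s0) ^+ 2 + complex.Im z ^+ 2) * cross P Q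
    + (r0 - s0) * cross ((z - (s0%:C)%C) * Q) P.
  by rewrite /cross; clear; case: (z) (P) (Q) => [x y] [p1 p2] [q1 q2] /=; ring.
have npos t : 0 < (complex.Re z - t) ^+ 2 + complex.Im z ^+ 2.
  by rewrite ltr_wpDl ?sqr_ge0 // exprn_gt0.
have C0 : 0 <= cross ((z - (r0%:C)%C) * P) ((z - (s0%:C)%C) * Q).
  rewrite step; apply: addr_ge0; apply: mulr_ge0 => //.
  - exact/ltW/npos.
  - by rewrite subr_ge0.
  - exact: ltW.
split.
  case: hA => [e|A1]; last first.
    right; rewrite step; apply: ltr_pwDl; first exact: mulr_gt0.
    by apply: mulr_ge0; [rewrite subr_ge0|exact: ltW].
  move: r0s0; rewrite le_eqVlt => /orP[/eqP e0|lt0]; first by left; rewrite e e0.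
  right; rewrite step; apply: ltr_wpDl; first by rewrite mulr_ge0 // ltW.
  by rewrite mulr_gt0 // subr_gt0.
move=> x /(_ isT) xr0.
(* The same expansion, now with [z - x = (z - r0) - (x - r0)]. *)
have -> : cross ((z - (x%:C)%C) * ((z - (s0%:C)%C) * Q)) ((z - (r0%:C)%C) * P) =
    ((complex.Re z - r0) ^+ 2 + complex.Im z ^+ 2) * cross ((z - (s0%:C)%C) * Q) P
    + (x - r0) * cross ((z - (r0%:C)%C) * P) ((z - (s0%:C)%C) * Q).
  by rewrite /cross; clear; case: (z) (P) (Q) => [x1 y] [p1 p2] [q1 q2] /=; ring.
by apply: ltr_pwDl; [exact: mulr_gt0|rewrite mulr_ge0 // subr_ge0].
Qed.

(** Without its head, [r] alternates left of [s]; the head, being right of all of [s], serves as [x]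
    in the second conclusion of [cross_alternating]. *)
Lemma cross_interlacing z r s : 0 < complex.Im z -> size r = (size s).+1 ->
  (forall i, (i < size s)%N -> r`_i.+1 <= s`_i <= r`_i) ->
  0 < cross (root_eval r z) (root_eval s z).
Proof.
case: r => [|r0 r] //= z0 [sz] h.
have [||_ hB] := cross_alternating z0 sz.
- by move=> i /h /andP[].
- by move=> i /h /andP[].
- by rewrite {1}/root_eval big_cons; apply: hB => /h /andP[].
Qed.

(** If [b z + a] were nonzero, then [l P / (m Q)], of positive imaginary part, would equal
    [- (d z + c) / (b z + a)], whose imaginary part is at most 0. Here [l], [m] stand for leading
    coefficients and [P], [Q] for values of monic polynomials. *)
Lemma linear_combination_upper_root (a b c d l m : R) z P Q :
  0 < complex.Im z -> 0 < cross P Q -> 0 < l * m -> b * c <= a * d ->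
  ((b%:C)%C * z + (a%:C)%C) * ((l%:C)%C * P) +
  ((d%:C)%C * z + (c%:C)%C) * ((m%:C)%C * Q) = 0 ->
  (b%:C)%C * z + (a%:C)%C = 0.
Proof.
rewrite /cross.
case: z P Q => [x y] [p1 p2] [q1 q2] /= y0 A0 lm0 hd.
set u1 := b * x + a; set u2 := b * y.
set v1 := d * x + c; set v2 := d * y.
move=> [e1 e2].
have {}e1 : l * (u1 * p1 - u2 * p2) + m * (v1 * q1 - v2 * q2) = 0.
  by rewrite -[RHS]e1 /u1 /u2 /v1 /v2; ring.
have {}e2 : l * (u1 * p2 + u2 * p1) + m * (v1 * q2 + v2 * q1) = 0.
  by rewrite -[RHS]e2 /u1 /u2 /v1 /v2; ring.
(* This is the imaginary part of [(d z + c) * (b z + a)^*]. *)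
have hv : 0 <= v2 * u1 - v1 * u2.
  have -> : v2 * u1 - v1 * u2 = y * (a * d - b * c).
    by rewrite /u1 /u2 /v1 /v2; ring.
  by rewrite mulr_ge0 ?subr_ge0 // ltW.
(* The imaginary part of the hypothesis times [l * (b z + a)^* * Q^*]. *)
have key : l ^+ 2 * ((u1 ^+ 2 + u2 ^+ 2) * (p2 * q1 - p1 * q2))
    + (l * m) * ((q1 ^+ 2 + q2 ^+ 2) * (v2 * u1 - v1 * u2)) = 0.
  transitivity (l * ((u1 * q1 - u2 * q2) *
      (l * (u1 * p2 + u2 * p1) + m * (v1 * q2 + v2 * q1))
    - (u1 * q2 + u2 * q1) *
      (l * (u1 * p1 - u2 * p2) + m * (v1 * q1 - v2 * q2)))); first by ring.
  by rewrite e1 e2; ring.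
have l0 : 0 < l ^+ 2.
  rewrite lt_def sqr_ge0 andbT sqrf_eq0.
  by apply: contraTneq lm0 => ->; rewrite mul0r ltxx.
have un : u1 ^+ 2 + u2 ^+ 2 = 0.
  apply/eqP; rewrite eq_le addr_ge0 ?sqr_ge0 // andbT leNgt; apply/negP => up.
  have : 0 < l ^+ 2 * ((u1 ^+ 2 + u2 ^+ 2) * (p2 * q1 - p1 * q2))
    + (l * m) * ((q1 ^+ 2 + q2 ^+ 2) * (v2 * u1 - v1 * u2)).
    apply: ltr_pwDl; first by do 2![apply: mulr_gt0 => //].
    apply: mulr_ge0; first exact: ltW.
    by apply: mulr_ge0 => //; rewrite addr_ge0 ?sqr_ge0.
  by rewrite key ltxx.
move/eqP: un; rewrite paddr_eq0 ?sqr_ge0 // !sqrf_eq0 => /andP[/eqP e3 /eqP e4].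
apply/eqP; rewrite eq_complex /=; apply/andP; split; apply/eqP.
  by rewrite -[RHS]e3 /u1; ring.
by rewrite -[RHS]e4 /u2; ring.
Qed.

Lemma linear_RZ (a b : R) : RZ (b *: 'X + a%:P).
Proof.
apply: RZ_no_upper_root => z z0; rewrite evalC_linear.
by case/(linear_no_upper_root z0) => -> ->; rewrite scale0r add0r.
Qed.

Lemma linear_mul_RZ (a b a' b' : R) :
  RZ ((b *: 'X + a%:P) * (b' *: 'X + a'%:P)).
Proof.
apply: RZ_no_upper_root => z z0; rewrite evalC_mul !evalC_linear.
move/eqP; rewrite mulf_eq0 => /orP[] /eqP /(linear_no_upper_root z0) [-> ->].
- by rewrite scale0r add0r mul0r.
- by rewrite scale0r add0r mulr0.
Qed.

Lemma lead_coef_mul_gt0 f g : f != 0 -> g != 0 ->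
  Num.sg (lead_coef f) = Num.sg (lead_coef g) ->
  0 < lead_coef f * lead_coef g.
Proof.
rewrite -(lead_coef_eq0 f) -(lead_coef_eq0 g) => f0 g0 e.
by rewrite -sgr_gt0 sgrM e -expr2 sqr_sg g0 ltr01.
Qed.

Lemma linear_combination_RZ (a b c d : R) f g r s :
  zeros f r -> zeros g s -> 0 < lead_coef f * lead_coef g ->
  b * c <= a * d ->
  (forall z, 0 < complex.Im z ->
     r = s \/ 0 < cross (root_eval r z) (root_eval s z)) ->
  RZ ((b *: 'X + a%:P) * f + (d *: 'X + c%:P) * g).
Proof.
move=> fr gs lm hd H; apply: RZ_no_upper_root => z z0.
rewrite evalC_add !evalC_mul !evalC_linear (evalC_zeros z fr) (evalC_zeros z gs).
case: (H z z0) => [rs|A0] Fz.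
  (* Proportional case: [F] is a linear polynomial times the common product. The linear factor
     vanishes at the nonreal [z], hence identically. *)
  set l := lead_coef f in lm Fz *; set m := lead_coef g in lm Fz *.
  have : (((b * l + d * m)%:C)%C * z + ((a * l + c * m)%:C)%C) * root_eval s z = 0.
    by rewrite -[RHS]Fz rs !(rmorphD, rmorphM) /=; ring.
  move/eqP; rewrite mulf_eq0 (negPf (root_eval_neq0 s z0)) orbF => /eqP.
  case/(linear_no_upper_root z0) => e1 e2.
  have [_ _ ->] := fr; have [_ _ ->] := gs; rewrite -/l -/m rs.
  set T := \prod_(x <- s) _.
  transitivity (((b * l + d * m) *: 'X + (a * l + c * m)%:P) * T).
    by rewrite -!mul_polyC !(rmorphD, rmorphM) /=; ring.
  by rewrite e1 e2 scale0r add0r mul0r.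
(* First [b = a = 0]; the surviving term of [F z] then forces [d = c = 0]. *)
have e := linear_combination_upper_root z0 A0 lm hd Fz.
have [b0 a0] := linear_no_upper_root z0 e.
move: Fz; rewrite e mul0r add0r => /eqP; rewrite !mulf_eq0.
rewrite (negPf (root_eval_neq0 s z0)) orbF.
have m0 : lead_coef g != 0 by apply: contraTneq lm => ->; rewrite mulr0 ltxx.
rewrite fmorph_eq0 (negPf m0) orbF => /eqP.
case/(linear_no_upper_root z0) => -> ->.
by rewrite b0 a0 scale0r addr0 !mul0r addr0.
Qed.

End UpperHalfPlane.

Theorem theorem1p1 (R : realType) (a b c d : R) (f g : {poly R})
  (hlead : f != 0 -> g != 0 -> Num.sg (lead_coef f) = Num.sg (lead_coef g))
  (hf : RZ f) (hg : RZ g) (hgf : leadsto g f) (hdet : b * c <= a * d) :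
  RZ ((b *: 'X + a%:P) * f + (d *: 'X + c%:P) * g).
Proof.
(* Stated separately because the convention on constants also reduces to it when [a'] and [b'] are
   nonzero. *)
have interlacing : interlaces g f ->
    RZ ((b *: 'X + a%:P) * f + (d *: 'X + c%:P) * g).
  move=> [r [s [fr gs sz h]]].
  have [f0 _ _] := fr; have [g0 _ _] := gs.
  apply: (linear_combination_RZ fr gs) => //.
    exact: lead_coef_mul_gt0 (hlead f0 g0).
  by move=> z z0; right; apply: cross_interlacing.
case: hgf => [//|[r [s [fr gs sz h1 h2]]]|[a' [b' [c' [ga fb]]]]].
  have [f0 _ _] := fr; have [g0 _ _] := gs.
  apply: (linear_combination_RZ fr gs) => //.
    exact: lead_coef_mul_gt0 (hlead f0 g0).
  by move=> z z0; case: (cross_alternating z0 sz h1 h2).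
(* With [g = 0], [F] is a product of two polynomials of degree at most 1. *)
have [a0|a0] := eqVneq a' 0.
  by rewrite ga a0 mulr0 addr0 fb; apply: linear_mul_RZ.
have [b0|b0] := eqVneq b' 0.
  suff -> : (b *: 'X + a%:P) * f + (d *: 'X + c%:P) * g =
      (b * c' + d * a') *: 'X + (a * c' + c * a')%:P by apply: linear_RZ.
  by rewrite ga fb b0 -!mul_polyC !(rmorphD, rmorphM) /=; ring.
have lf : lead_coef f = b'.
  rewrite fb lead_coefDl ?lead_coefZ ?lead_coefX ?mulr1 //.
  by rewrite size_scale // size_polyX size_polyC; case: (c' != 0).
(* A nonzero constant has no zeros, so it interlaces a polynomial of degree 1 vacuously. *)
apply: interlacing; exists [:: - c' / b'], [::]; split => //; split => //.
- by rewrite -lead_coef_eq0 lf.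
- rewrite lf big_seq1 fb -!mul_polyC rmorphM rmorphN /= mulrBr mulNr mulrN opprK.
  by rewrite mulrCA -polyCM divff // mulr1.
- by rewrite ga polyC_eq0.
- by rewrite ga lead_coefC big_nil -mul_polyC mulr1.
Qed.
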